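(* Let $T$ be an automorphism of a standard $\sigma$-finite measure space $(X_0,\mathfrak{B}_0,\mu_0)$, let $\xi:X_0\to\mathbb{R}$ be a positive measurable function, and let $\{F_t\}_{t\in\mathbb{R}}$ be the flow built under the function $\xi$ with base automorphism $T$. For measurable $A\subseteq X_0$ and $s,\delta>0$ put $$\Delta_{F,\delta,s}(A)=\{x\in A:\ \exists t\in(e^{s-\delta},e^{s+\delta})\cup(-e^{s+\delta},-e^{s-\delta}),\ F_t(x,0)\in A\times\{0\}\}.$$ Then $\{F_t\}_{t\in\mathbb{R}}$ has Property B if and only if there exists a measurable set $A_0\subseteq X_0$ of positive measure such that, for all $\delta>0$, $$\limsup_{s\to\infty}\mu_0(\Delta_{F,\delta,s}(A_0))=0.$$
   Context: Automorphisms are nonsingular. The flow built under the function $\xi$ with base automorphism $T$ is defined on $Y=\{(x,u)\in X_0\times\mathbb{R}:0\le u<\xi(x)\}$ equipped with the restriction $\nu$ of $\mu_0\times\lambda$ ($\lambda$ Lebesgue measure on $\mathbb{R}$), by: for $t>0$, $F_t(x,u)=(x,t+u)$ if $0\le t+u<\xi(x)$; $F_t(x,u)=(T(x),t+u-\xi(x))$ if $\xi(x)\le t+u<\xi(x)+\xi(T(x))$; and so on; $F_{-t}=F_t^{-1}$, $F_0=\mathrm{id}$. As part of the notion of a flow built under a function, $\sum_{i\ge0}\xi(T^ix)=\sum_{i\ge1}\xi(T^{-i}x)=\infty$ for a.e. $x$, so that $F_t$ is defined for all $t\in\mathbb{R}$. Property B: for a measurable flow $\{F_t\}_{t\in\mathbb{R}}$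 of nonsingular automorphisms of $(Y,\nu)$, a measurable $A\subseteq Y$ of positive measure and $s,\delta>0$ let $\Lambda_{F,\delta,s}(A)=\{y\in A:\ \exists t\in(e^{s-\delta},e^{s+\delta})\cup(-e^{s+\delta},-e^{s-\delta}),\ F_t(y)\in A\}$. The flow has Property B if there exists a measurable set $A\subseteq Y$ of positive measure such that for all $\delta>0$, $\limsup_{s\to\infty}\nu(\Lambda_{F,\delta,s}(A))=0$. *)

(* Defs.v *)
From HB Require Import structures.
From mathcomp Require Import all_boot all_order all_algebra.
From mathcomp Require Import all_classical all_reals all_analysis.
From mathcomp Require Import measurable_realfun.
Set Implicit Arguments.
Unset Strict Implicit.
Unset Printing Implicit Defensive.
Import Order.TTheory GRing.Theory Num.Theory.
Import numFieldNormedType.Exports.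

Local Open Scope classical_set_scope.
Local Open Scope ring_scope.

(* Isomorphic to a Borel subset of a complete separable metric space; passing
   through a subset also covers the empty space, since completePseudoMetricType
   is pointed.  A Hausdorff pseudometric is a metric. *)
Definition standard_borel (R : realType) d (X : measurableType d) : Prop :=
  exists (P : completePseudoMetricType R) (f : X -> P),
    [/\ hausdorff_space P,
        exists2 D : set P, countable D & dense D,
        injective f,
        <<s open >> (range f)
      & forall A : set X, measurable A <->
          exists2 B : set P, <<s open >> B & A = f @^-1` B].

Record automorphism (R : realType) d (X : measurableType d)
    (mu : {measure set X -> \bar R}) := Automorphism {
  aut_fun :> X -> X ;
  aut_inv : X -> X ;
  aut_funK : cancel aut_fun aut_inv ;
  aut_invK : cancel aut_inv aut_fun ;
  measurable_aut : measurable_fun setT aut_fun ;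
  measurable_aut_inv : measurable_fun setT aut_inv ;
  aut_nonsingular : forall A : set X, measurable A ->
    (mu (aut_fun @^-1` A) = 0%E <-> mu A = 0%E) }.

Section property_B.
Context {R : realType}.

Definition return_window (delta s : R) : set R :=
  [set t | expR (s - delta) < t < expR (s + delta)] `|`
  [set t | - expR (s + delta) < t < - expR (s - delta)].

Definition Lambda (Z : Type) (F : R -> Z -> Z) (delta s : R) (A : set Z) :
    set Z :=
  [set y | A y /\ exists2 t, return_window delta s t & A (F t y)].

(* [Lambda F delta s A] is a projection along t, so it need not belong to the
   sigma-algebra, only to its completion.  [nu^*] is the outer measure induced
   by nu; it coincides with nu on measurable sets and with the completion of a
   sigma-finite nu on the completed sigma-algebra.  The phase space is the
   subset Y of the ambient type Z, and nu is carried by Y. *)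
Definition property_B d (Z : measurableType d)
    (nu : {measure set Z -> \bar R}) (Y : set Z) (F : R -> Z -> Z) : Prop :=
  exists A : set Z, [/\ measurable A, A `<=` Y, (0 < nu A)%E &
    forall delta : R, 0 < delta ->
      limf_esup (fun s : R => (nu^*)%mu (Lambda F delta s A)) +oo%R = 0%E].

End property_B.

Section flow_built_under.
Context {R : realType} d (X : measurableType d).
Context (mu : {measure set X -> \bar R}) (T : automorphism mu).
Context (xi : {mfun X >-> R}).

Definition flow_space : set (X * R) := [set y | 0 <= y.2 < xi y.1].

Lemma measurable_flow_space :
  measurable (flow_space : set (X * measurableTypeR R)).
Proof.
have -> : flow_space =
    (snd @^-1` `[0, +oo[) `&` ((fun y => xi y.1 - y.2) @^-1` `]0, +oo[).
  apply/seteqP; split => -[x u] /=; rewrite !in_itv/= !andbT subr_gt0.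
    by move/andP.
  by case=> u0 ux; apply/andP.
apply: measurableI; rewrite -[X in measurable X]setTI.
  by apply: measurable_snd => //; exact: measurable_itv.
have mf : measurable_fun setT (fun y : X * R => xi y.1 - y.2).
  by apply: measurable_funB => //; exact: measurableT_comp.
by apply: mf => //; exact: measurable_itv.
Qed.

Definition flow_measure : {measure set (X * measurableTypeR R) -> \bar R} :=
  mrestr (mu \x lebesgue_measure)%E measurable_flow_space.

(* The points x over which F_t(x, u) is defined for all real t. *)
Definition divergence_set : set X := [set x |
  (\sum_(0 <= i <oo) (xi (iter i T x))%:E = +oo)%E /\
  (\sum_(1 <= i <oo) (xi (iter i (aut_inv T) x))%:E = +oo)%E].

Definition ceiling_sum (n : nat) (x : X) : R := \sum_(i < n) xi (iter i T x).

(* The graph z = F_t(y) for t > 0. *)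
Definition forward_graph (t : R) (y z : X * R) : Prop :=
  exists n : nat,
    ceiling_sum n y.1 <= t + y.2 < ceiling_sum n.+1 y.1 /\
    z = (iter n T y.1, t + y.2 - ceiling_sum n y.1).

Definition flow_graph (t : R) (y z : X * R) : Prop :=
  if 0 < t then forward_graph t y z
  else if t < 0 then forward_graph (- t) z y
  else z = y.

(* F_t(y) is the point of flow_space related to y by flow_graph, which exists
   and is unique when y lies in flow_space over divergence_set (built_flowP).
   Off that T-invariant set F_t is the identity, so that F is an everywhere
   defined flow. *)
Definition built_flow (t : R) (y : X * R) : X * R :=
  xget y [set z |
    [/\ divergence_set y.1, flow_space y, flow_space z & flow_graph t y z]].

Section built_flow_spec.
Context (xi_gt0 : forall x, 0 < xi x).

Let ceiling_sumS n x : ceiling_sum n.+1 x = ceiling_sum n x + xi (iter n T x).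
Proof. by rewrite /ceiling_sum big_ord_recr. Qed.

Let ceiling_sumD m n x :
  ceiling_sum (m + n) x = ceiling_sum m x + ceiling_sum n (iter m T x).
Proof.
elim: n => [|n IH]; first by rewrite addn0 /ceiling_sum big_ord0 addr0.
by rewrite addnS !ceiling_sumS IH addrA -iterD addnC.
Qed.

Let ceiling_sum_le m n x :
  (m <= n)%N -> ceiling_sum m x <= ceiling_sum n x.
Proof.
move/subnKC => <-; rewrite ceiling_sumD lerDl.
by apply: sumr_ge0 => i _; exact: ltW.
Qed.

Let divergent_exceeds (f : nat -> R) (m : nat) (c : R) :
  (forall i, 0 <= f i) -> (\sum_(m <= i <oo) (f i)%:E = +oo)%E ->
  exists n, c < \sum_(m <= i < n) f i.
Proof.
move=> f0 foo; apply: contrapT => /forallNP h.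
suff : (\sum_(m <= i <oo) (f i)%:E <= c%:E)%E by rewrite foo.
apply: lime_le; first by apply: is_cvg_nneseries => i _ _; rewrite lee_fin.
by near=> n; rewrite sumEFin lee_fin leNgt; apply/negP/h.
Unshelve. all: by end_near. Qed.

Let iterTK n : cancel (iter n (aut_inv T)) (iter n T).
Proof. by elim: n => // n IH x; rewrite iterSr /= aut_invK IH. Qed.

Let iterTinj n : injective (iter n T).
Proof.
elim: n => // n IH x y; rewrite !iterS => /(can_inj (aut_funK T)).
exact: IH.
Qed.

Let ceiling_sum_back n x : ceiling_sum n (iter n (aut_inv T) x) =
  \sum_(1 <= i < n.+1) xi (iter i (aut_inv T) x).
Proof.
elim: n => [|n IH]; first by rewrite /ceiling_sum big_ord0 big_geq.
rewrite -[n.+1 in LHS]add1n ceiling_sumD big_nat_recr//= -IH addrC.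
by rewrite aut_invK /ceiling_sum big_ord1.
Qed.

Let forward_ex t y : 0 < t -> flow_space y -> divergence_set y.1 ->
  exists z, flow_space z /\ forward_graph t y z.
Proof.
case: y => x u; rewrite /flow_space /= => t0 /andP[u0 uxi] [div _].
have [n0 hn0] := divergent_exceeds (t + u) (fun i => ltW (xi_gt0 _)) div.
have ex : exists n, t + u < ceiling_sum n x by exists n0; rewrite big_mkord in hn0.
case: (ex_minnP ex) => -[|n] hn hmin.
  by move: hn; rewrite /ceiling_sum big_ord0 ltNge addr_ge0// ltW.
have le : ceiling_sum n x <= t + u.
  by rewrite leNgt; apply/negP => /hmin; rewrite ltnn.
exists (iter n T x, t + u - ceiling_sum n x); split => /=.
  by rewrite subr_ge0 le ltrBlDl -ceiling_sumS.
by exists n; rewrite /= le hn.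
Qed.

Let forward_uniq t y z1 z2 :
  forward_graph t y z1 -> forward_graph t y z2 -> z1 = z2.
Proof.
move=> [m [/andP[m1 m2] ->]] [n [/andP[n1 n2] ->]].
have H a b c : ceiling_sum a y.1 <= c -> c < ceiling_sum b.+1 y.1 -> (a <= b)%N.
  move=> h1 h2; rewrite leqNgt; apply/negP => /(@ceiling_sum_le _ _ y.1) h3.
  by have := lt_le_trans (le_lt_trans h1 h2) h3; rewrite ltxx.
suff -> : m = n by [].
by apply/eqP; rewrite eqn_leq (H _ _ _ m1 n2) (H _ _ _ n1 m2).
Qed.

Let backward_ex s y : 0 < s -> flow_space y -> divergence_set y.1 ->
  exists z, flow_space z /\ forward_graph s z y.
Proof.
case: y => x u; rewrite /flow_space /= => s0 /andP[u0 uxi] [_ div].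
have [n0 hn0] := divergent_exceeds (s - u) (fun i => ltW (xi_gt0 _)) div.
pose B n := ceiling_sum n (iter n (aut_inv T) x).
have ex : exists n, s - u <= B n.
  exists n0; rewrite /B ceiling_sum_back; apply: (le_trans (ltW hn0)).
  case: n0 {hn0} => [|n0]; first by rewrite !big_geq.
  by rewrite [X in _ <= X]big_nat_recr//= lerDl ltW.
case: (ex_minnP ex) => n hn hmin.
set x' := iter n (aut_inv T) x.
have E : s + (u - s + B n) = u + ceiling_sum n x' by rewrite /B -/x' addrA subrKC.
exists (x', u - s + B n); split => /=.
  apply/andP; split; first by rewrite -opprB addrC subr_ge0.
  case: n @x' hn hmin E => [|n] x' hn hmin E.
    rewrite /B /= /ceiling_sum big_ord0 addr0 (le_lt_trans _ uxi)//.
    by rewrite gerBl ltW.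
  rewrite /B ceiling_sum_back big_nat_recr//= -ceiling_sum_back -/(B n) addrA.
  rewrite gtrDr -opprB addrC subr_lt0 ltNge; apply/negP => /hmin.
  by rewrite ltnn.
exists n; rewrite /= E iterTK addrK; split=> //.
by rewrite ceiling_sumS iterTK lerDr u0 addrC ltrD2l.
Qed.

Let backward_uniq s y z1 z2 : flow_space z1 -> flow_space z2 ->
  forward_graph s z1 y -> forward_graph s z2 y -> z1 = z2.
Proof.
move=> f1 f2 [m [_ ->]] [n [_]]; move: m n z1 z2 f1 f2.
suff H m n z1 z2 : (m <= n)%N -> flow_space z1 -> flow_space z2 ->
    (iter m T z1.1, s + z1.2 - ceiling_sum m z1.1) =
    (iter n T z2.1, s + z2.2 - ceiling_sum n z2.1) -> z1 = z2.
  move=> m n z1 z2 f1 f2; have [mn|/ltnW nm] := leqP m n; first exact: H mn _ _.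
  by move=> /esym h; apply/esym; exact: H nm _ _ h.
case: z1 z2 => [x1 u1] [x2 u2]; rewrite /flow_space /=.
move=> /subnKC <- /andP[p1 q1] /andP[p2 q2] [].
set k := (n - m)%N; rewrite [(m + k)%N]addnC.
rewrite addnC iterD => /iterTinj ->.
rewrite addnC ceiling_sumD opprD addrA => /addIr h.
case: k h => [|k] h.
  by move: h; rewrite /ceiling_sum big_ord0 subr0 => /addrI ->.
have : xi x2 <= u2.
  have -> : u2 = u1 + ceiling_sum k.+1 x2.
    by apply: (@addrI _ s); rewrite addrA h subrK.
  have c1 : xi x2 = ceiling_sum 1 x2 by rewrite /ceiling_sum big_ord1.
  by rewrite c1 -[leLHS]add0r lerD// ceiling_sum_le.
by rewrite leNgt q2.
Qed.

Lemma built_flowP t y : flow_space y -> divergence_set y.1 ->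
  [/\ flow_space (built_flow t y), flow_graph t y (built_flow t y) &
      forall z, flow_space z -> flow_graph t y z -> z = built_flow t y].
Proof.
move=> fy dy.
have ex : exists z, flow_space z /\ flow_graph t y z.
  rewrite /flow_graph; case: ltgtP => t0; last by exists y.
    exact: forward_ex.
  by apply: backward_ex => //; rewrite oppr_gt0.
have uniq z1 z2 : flow_space z1 -> flow_space z2 ->
    flow_graph t y z1 -> flow_graph t y z2 -> z1 = z2.
  rewrite /flow_graph; case: ltgtP => t0 f1 f2.
  - exact: forward_uniq.
  - exact: backward_uniq.
  - by move=> -> ->.
rewrite /built_flow; case: xgetP => [w wE [_ _ fw gw]|none].
  by split=> // z fz gz; exact: uniq.
by case: ex => z [fz gz]; case: (none z).
Qed.

Lemma built_flow_id t y : ~ divergence_set y.1 -> built_flow t y = y.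
Proof. by move=> dy; rewrite /built_flow; case: xgetP => // z _ []. Qed.

End built_flow_spec.

Definition Delta (delta s : R) (A : set X) : set X :=
  [set x | A x /\ exists2 t, return_window delta s t &
                    (A `*` [set 0]) (built_flow t (x, 0))].

End flow_built_under.

(* Main.v *)
Require Import Defs.
From mathcomp Require Import all_boot all_order all_algebra.
From mathcomp Require Import all_classical all_reals all_analysis.
From mathcomp Require Import measurable_realfun.
From mathcomp Require Import lra.
Set Implicit Arguments.
Unset Strict Implicit.
Unset Printing Implicit Defensive.
Import Order.TTheory GRing.Theory Num.Theory.
Import numFieldNormedType.Exports.
Local Open Scope classical_set_scope.
Local Open Scope ring_scope.

(** The two properties are compared by passing between subsets of the flow
    space and subsets of the base, at the price of replacing [delta] by
    [2 * delta], which is harmless as all [delta > 0] are quantified over.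

    Suppose that [y], [z = F_t y] have heights [u], [u'], and that [y'], [z']
    lie over the same base points with heights [v], [w].  Sliding along the
    fibres shows that [z'] is the image of [y'] under [F_(t + r)] with
    [r = (u - u') - (v - w)].  If all heights are below [c] then
    [`|r| <= 2 * c], while the two gaps between the endpoints of the windows of
    parameters [delta] and [2 * delta] tend to infinity with [s]; so for large
    [s] a return in the [delta]-window becomes a return in the
    [2 * delta]-window ([window_shift], [Lambda_shift]).  As [Delta] is [Lambda]
    for the set [A0 `*` [set 0]], this compares both kinds of return sets.

    From a flow set [A] to a base set ([property_B_base]): some truncation [low]
    of [A] at bounded height has positive measure, and by Tonelli the base
    points whose vertical section in [low] has length more than some [a > 0]
    form a set [A0] of positive measure.  The part of [low] over
    [Delta delta s A0] lies in [Lambda (2 * delta) s A], hence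
    [a * mu (Delta delta s A0)] is at most the outer measure of
    [Lambda (2 * delta) s A].

    From a base set [A0] to a flow set ([property_B_of_base]): some [c > 0] is
    below the ceiling on a subset [E] of [A0] of positive measure, and the
    rectangle [A = E `*` [0, c[] satisfies
    [Lambda delta s A `<=` Delta (2 * delta) s A0 `*` [0, c[], a set of measure
    [c * mu (Delta (2 * delta) s A0)].

    Both estimates use that [Delta] is measurable ([measurable_Delta]): starting
    from height 0, the flow meets height 0 only at the times
    [ceiling_sum n x] and [- ceiling_sum n (T^-n x)], so [Delta] is a countable
    union of measurable sets. *)

(** * Superior limits *)

Lemma limf_esup_eq0_dominated (R : realType) (F : set_system R)
    (FF : ProperFilter F) (c : R) (f g : R -> \bar R) :
  0 < c -> (forall x, 0 <= f x)%E -> (forall x, 0 <= g x)%E ->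
  (\forall x \near F, (g x <= c%:E * f x)%E) ->
  limf_esup f F = 0%E -> limf_esup g F = 0%E.
Proof.
move=> c0 f0 g0 gf lf; apply/eqP; rewrite eq_le; apply/andP; split; last first.
  by apply: limf_esup_ge0 => //; exact: filter_not_empty.
apply/lee_addgt0Pr => e e0; rewrite add0e.
have : (limf_esup f F < (e / c)%:E)%E by rewrite lf lte_fin divr_gt0.
rewrite limf_esupE => /ereal_inf_lt[_ [V FV <-] supV].
rewrite limf_esupE; apply: ge_ereal_inf.
exists (ereal_sup (g @` (V `&` [set x | (g x <= c%:E * f x)%E]))).
  by exists (V `&` [set x | (g x <= c%:E * f x)%E]) => //; exact: filterI.
apply: ge_ereal_sup => _ [x [Vx gx] <-]; apply: (le_trans gx).
have fx : (f x <= (e / c)%:E)%E.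
  by apply: le_trans (ltW supV); apply: ereal_sup_ubound; exists x.
have -> : e%:E = (c%:E * (e / c)%:E)%E.
  by rewrite -EFinM mulrCA divff ?mulr1// gt_eqF.
by apply: lee_wpmul2l => //; rewrite lee_fin ltW.
Qed.

(** * Perturbing a return time *)

(** Translates of the exponential separate at a linear rate, since
    [expR (a + e) - expR a >= expR a * e >= a * e]. *)
Lemma expR_gap (R : realType) (a e c : R) :
  0 < e -> 0 <= c -> c / e <= a -> expR a + c <= expR (a + e).
Proof.
move=> e0 c0; rewrite ler_pdivrMr// => ca.
rewrite expRD; have := expR_ge1Dx a; have := expR_ge1Dx e.
move: (expR a) (expR e) (expR_gt0 a) => p q p0 qe pa.
by have := ler_wpM2l (ltW p0) qe; nra.
Qed.

(** Both endpoints of the [delta]-window are, for large [s], at distance at least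
    [c] from the corresponding endpoints of the [2 * delta]-window. *)
Lemma window_shift (R : realType) (delta s c r t : R) :
  0 < delta -> 0 <= c -> 2 * delta + c / delta <= s -> `|r| <= c ->
  expR (s - delta) < t < expR (s + delta) ->
  expR (s - 2 * delta) < t + r < expR (s + 2 * delta).
Proof.
move=> d0 c0 cs; rewrite ler_norml => /andP[r1 r2] /andP[t1 t2].
have cd : 0 <= c / delta by rewrite divr_ge0// ltW.
have := @expR_gap _ (s + delta) _ _ d0 c0.
have := @expR_gap _ (s - 2 * delta) _ _ d0 c0.
have -> : s - 2 * delta + delta = s - delta by lra.
have -> : s + delta + delta = s + 2 * delta by lra.
move=> H1 H2.
have {}H1 := H1 ltac:(lra); have {}H2 := H2 ltac:(lra).
by apply/andP; split; lra.
Qed.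

(** * Positive measure and vertical sections *)

Lemma measure_bigcup_gt0 d (T : measurableType d) (R : realType)
    (mu : {measure set T -> \bar R}) (F : (set T)^nat) :
  (forall k, measurable (F k)) -> (0 < mu (\bigcup_k F k))%E ->
  exists k, (0 < mu (F k))%E.
Proof.
move=> mF muF; apply: contrapT => /forallNP F0.
have mUF := bigcupT_measurable _ mF.
suff /(measure_negligible mUF) muF0 : mu.-negligible (\bigcup_k F k).
  by rewrite muF0 ltxx in muF.
apply: negligible_bigcup => k; apply/negligibleP => //.
by apply/eqP; rewrite eq_le measure_ge0 andbT leNgt; apply/negP/F0.
Qed.

Section product_sections.
Local Open Scope ereal_scope.
Context d1 d2 (X : measurableType d1) (Y : measurableType d2) (R : realType).
Variables (m1 : {measure set X -> \bar R}).
Variables (m2 : {sigma_finite_measure set Y -> \bar R}).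

Lemma measurable_xsection_gt (A : set (X * Y)) (a : \bar R) :
  measurable A -> measurable [set x | a < m2 (xsection A x)].
Proof.
move=> mA; rewrite -[X in measurable X]setTI.
by apply: emeasurable_fun_o_infty => //; exact: (measurable_fun_xsection m2).
Qed.

(** If the set of points with a section of positive measure were null, the
    product measure, which is the integral of the measures of the sections,
    would vanish; that set is the union over [k] of the sets considered here. *)
Lemma product_measure_gt0_sections (A : set (X * Y)) :
  measurable A -> 0 < (m1 \x m2) A ->
  exists k, 0 < m1 [set x | k.+1%:R^-1%:E < m2 (xsection A x)].
Proof.
move=> mA A0; apply: measure_bigcup_gt0 => [k|].
  exact: measurable_xsection_gt.
have -> : \bigcup_k [set x | k.+1%:R^-1%:E < m2 (xsection A x)] =
    [set x | 0 < m2 (xsection A x)].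
  apply/seteqP; split => [x [k _ /=]|x /= px].
    by apply: lt_trans; rewrite lte_fin.
  move: px; case Ex : (m2 (xsection A x)) => [r| |] // => [r0|_]; last first.
    by exists 0%N => //=; rewrite Ex ltry.
  have [k rk] := ltr_add_invr r0; exists k => //=.
  by rewrite Ex lte_fin; move: rk; rewrite add0r.
rewrite lt0e measure_ge0 andbT; apply/eqP => m0.
move: A0; rewrite [ltRHS](_ : _ = 0) ?ltxx//.
rewrite /product_measure1.
rewrite (@ge0_ae_eq_integral _ _ _ _ _ _ (cst 0)) ?integral0//.
- exact: measurable_fun_xsection.
- exists [set x | 0 < m2 (xsection A x)]; split => //.
    exact: measurable_xsection_gt.
  move=> x /= nx; rewrite lt0e measure_ge0 andbT; apply/eqP => x0.
  by apply: nx => _.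
Qed.

(** Chebyshev's inequality for the function [x |-> m2 (xsection A x)]. *)
Lemma product_measure_ge_sections (A : set (X * Y)) (D : set X) (a : R) :
  measurable A -> measurable D -> (0 <= a)%R ->
  (forall x, D x -> a%:E <= m2 (xsection A x)) ->
  a%:E * m1 D <= (m1 \x m2) A.
Proof.
move=> mA mD a0 aA; rewrite -integral_cst//.
apply: (@le_trans _ _ (\int[m1]_(x in D) m2 (xsection A x))).
  apply: ge0_le_integral => //.
  apply: measurable_funTS; exact: (measurable_fun_xsection m2 mA).
apply: ge0_subset_integral => //.
exact: (measurable_fun_xsection m2 mA).
Qed.

End product_sections.

Section returns.
Context {R : realType} {d : measure_display} {X : measurableType d}.
Context {mu : {measure set X -> \bar R}} (T : automorphism mu).
Context (xi : {mfun X >-> R}) (xi_gt0 : forall x, 0 < xi x).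

Local Notation F := (built_flow T xi).

(** * Return times along the flow *)

Lemma ceiling_sumS n x :
  ceiling_sum T xi n.+1 x = ceiling_sum T xi n x + xi (iter n T x).
Proof. by rewrite /ceiling_sum big_ord_recr. Qed.

(** The number [n] of crossings of the ceiling depends only on the base points;
    the change of the heights is absorbed by the time. *)
Lemma forward_graph_shift t x u x' u' v w :
  forward_graph T xi t (x, u) (x', u') -> 0 <= w < xi x' ->
  forward_graph T xi (t + ((u - u') - (v - w))) (x, v) (x', w).
Proof.
move=> [n [/= _ [-> ->]]] /andP[w0 wxi]; exists n.
have -> : t + (u - (t + u - ceiling_sum T xi n x) - (v - w)) + v =
    ceiling_sum T xi n x + w by lra.
split => /=; last by rewrite addrAC subrr add0r.
by rewrite ceiling_sumS lerDl w0 ltrD2l.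
Qed.

(** Comparison of the return sets of two sets of bounded height, which is used
    with a flow set and a set of base points at height 0, in either order. *)
Lemma Lambda_shift (c delta s : R) (B B' : set (X * R)) (y y' : X * R) :
  0 < delta -> 0 <= c -> 2 * delta + (2 * c) / delta <= s ->
  (forall z, B z -> flow_space xi z /\ z.2 < c) ->
  (forall z, B' z -> flow_space xi z /\ z.2 < c) ->
  (forall z, B z -> exists2 z', B' z' & z'.1 = z.1) ->
  y'.1 = y.1 -> B' y' -> Lambda F delta s B y -> Lambda F (2 * delta) s B' y'.
Proof.
move=> d0 c0 cs hB hB' proj yy' B'y' [By [t wt BFy]].
(* Off the divergence set the flow fixes [y'], which thus returns at any time
   of the window, for instance [expR s]. *)
have [dy|ndy] := pselect (divergence_set T xi y.1); last first.
  split => //; exists (expR s); last by rewrite built_flow_id ?yy'.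
  by left; rewrite /= !ltr_expR; lra.
split => //; have [fy yc] := hB _ By; have [fy' yc'] := hB' _ B'y'.
have [_ gFy _] := built_flowP xi_gt0 t fy dy.
move: gFy BFy; set z := F t y; move=> gz Bz.
have [z' B'z' zz'] := proj _ Bz.
have [fz zc] := hB _ Bz; have [fz' zc'] := hB' _ B'z'.
have dy' : divergence_set T xi y'.1 by rewrite yy'.
clearbody z.
move: y y' z z' yy' zz' fy fy' fz fz' yc yc' zc zc' gz B'z' dy' {By B'y' Bz dy}.
move=> [x u] [xv v] [x' u'] [xw w] /= -> -> fu fv fu' fw uc vc u'c wc gz B'z'.
move=> dx.
have [/andP[u0 _] /andP[v0 _]] := (fu, fv).
have [/andP[u'0 _] /andP[w0 _]] := (fu', fw).
rewrite /= in u0 v0 u'0 w0 uc vc u'c wc.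
set r := (u - u') - (v - w).
have rc : `|r| <= 2 * c by rewrite /r ler_norml; apply/andP; split; lra.
have flowE t' : flow_graph T xi t' (x, v) (x', w) -> F t' (x, v) = (x', w).
  by move=> g; have [_ _ /(_ (x', w) fw g) ->] := built_flowP xi_gt0 t' fv dx.
have c20 : 0 <= 2 * c by lra.
(* [flow_graph] branches on the sign of the time, so it matters that [t + r]
   keeps the sign of [t]: both times lie in windows, on the same side of 0. *)
case: wt => /= wt.
  have wt' := window_shift d0 c20 cs rc wt.
  exists (t + r); first by left.
  rewrite flowE//; move: gz; rewrite /flow_graph.
  have -> : 0 < t by case/andP: wt => + _; exact/lt_trans/expR_gt0.
  have -> : 0 < t + r by case/andP: wt' => + _; exact/lt_trans/expR_gt0.
  by move/forward_graph_shift; apply.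
have {}wt : expR (s - delta) < - t < expR (s + delta).
  by apply/andP; case/andP: wt; lra.
have rc' : `|- r| <= 2 * c by rewrite normrN.
have wt' := window_shift d0 c20 cs rc' wt.
exists (t + r); first by right => /=; apply/andP; case/andP: wt'; lra.
rewrite flowE//; move: gz; rewrite /flow_graph.
have tn : t < 0.
  by rewrite -oppr_gt0; case/andP: wt => + _; exact/lt_trans/expR_gt0.
have trn : t + r < 0.
  rewrite -oppr_gt0 opprD; case/andP: wt' => + _; exact/lt_trans/expR_gt0.
rewrite (ltNge 0 t) (ltW tn) (ltNge 0 (t + r)) (ltW trn) tn trn/=.
move/(forward_graph_shift w); move/(_ v fv).
by congr (forward_graph _ _ _ _ _); rewrite /r; lra.
Qed.

Lemma Delta_Lambda (delta s : R) (A : set X) (x : X) :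
  Delta T xi delta s A x <-> Lambda F delta s (A `*` [set 0]) (x, 0).
Proof. by split => [[Ax h]|[[Ax _] h]]; split. Qed.

(** * Measurability of the return set of the base *)

Lemma measurable_iter (f : X -> X) n :
  measurable_fun setT f -> measurable_fun setT (iter n f).
Proof.
move=> mf; elim: n => [|n IH] /=; first exact: measurable_id.
exact: (measurableT_comp mf IH).
Qed.

Lemma measurable_divergence_set : measurable (divergence_set T xi).
Proof.
have mS (f : X -> X) m : measurable_fun setT f ->
    measurable [set x | (\sum_(m <= i <oo) (xi (iter i f x))%:E = +oo)%E].
  move=> mf.
  have mg : measurable_fun setT
      (fun x => \sum_(m <= i <oo) (xi (iter i f x))%:E)%E.
    apply: (@emeasurable_fun_cvg _ _ _ _
      (fun n x => \sum_(m <= i < n) (xi (iter i f x))%:E)%E).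
      move=> n; apply: emeasurable_sum => i.
      apply/measurable_EFinP; apply: measurableT_comp => //.
      exact: measurable_iter.
    by move=> x _; apply: is_cvg_nneseries => i _ _; rewrite lee_fin ltW.
  by have := mg measurableT _ (emeasurable_set1 +oo%E); rewrite setTI.
by apply: measurableI; apply: mS;
  [exact: measurable_aut | exact: measurable_aut_inv].
Qed.

Lemma iter_cancel (f g : X -> X) n : cancel f g -> cancel (iter n f) (iter n g).
Proof. by move=> fK; elim: n => // n IH x; rewrite iterSr /= fK IH. Qed.

Definition ceiling_hit (delta s : R) (n : nat) : set X :=
  [set x | expR (s - delta) < ceiling_sum T xi n x < expR (s + delta)].

(** At height 0 the flow graph [z = F_t y] with [t > 0] forces
    [t = ceiling_sum n x] where [n] is the number of crossings.  Negative times
    are positive return times read from the end point [T^-n x]. *)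
Lemma DeltaE (delta s : R) (A : set X) : 0 < delta ->
  Delta T xi delta s A = A `&` (~` divergence_set T xi `|`
    \bigcup_n (ceiling_hit delta s n `&` iter n T @^-1` A `|`
      iter n (aut_inv T) @^-1` (ceiling_hit delta s n `&` A))).
Proof.
move=> d0; have f0 x : flow_space xi (x, 0) by rewrite /flow_space /= lexx /=.
have hit n x t w : ceiling_sum T xi n x <= t + 0 < ceiling_sum T xi n.+1 x /\ 
    (w, 0) = (iter n T x, t + 0 - ceiling_sum T xi n x) ->
    t = ceiling_sum T xi n x /\ w = iter n T x.
  by move=> [_ [-> /esym/eqP]]; rewrite addr0 subr_eq0 => /eqP.
have fwd n x : forward_graph T xi (ceiling_sum T xi n x) (x, 0) (iter n T x, 0).
  exists n; rewrite /= addr0 subrr lexx; split => //=.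
  by rewrite ceiling_sumS ltrDl.
apply/seteqP; split => x.
  move=> [Ax [t wt AFx]]; split => //.
  have [dx|] := pselect (divergence_set T xi x); [right|by left].
  have [_ + _] := built_flowP xi_gt0 t (f0 x) dx.
  case: (F t (x, 0)) AFx => x' _ [/= Ax' ->]; rewrite /flow_graph.
  case: wt => /= wt.
    have -> : 0 < t by case/andP: wt => + _; exact/lt_trans/expR_gt0.
    move=> [n /hit[tn xn]]; exists n => //; left.
    by rewrite /ceiling_hit /= -tn -xn.
  have tn : t < 0.
    by case/andP: wt => _ /lt_trans; apply; rewrite oppr_lt0 expR_gt0.
  rewrite (ltNge 0 t) (ltW tn) tn /= => -[n /hit[tn' xn]].
  exists n => //; right.
  rewrite /ceiling_hit /= xn (iter_cancel _ (aut_funK T)) -tn'; split => //.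
  by apply/andP; case/andP: wt; lra.
move=> [Ax]; have [dx|ndx _] := pselect (divergence_set T xi x); last first.
  split => //; exists (expR s); last by rewrite built_flow_id.
  by left; rewrite /= !ltr_expR; lra.
case=> // -[n _ [[hn An]|[hn An]]]; split => //.
  exists (ceiling_sum T xi n x); first by left.
  have [_ _ /(_ (iter n T x, 0) (f0 _)) <-//] :=
    built_flowP xi_gt0 (ceiling_sum T xi n x) (f0 x) dx.
  by rewrite /flow_graph ifT//; case/andP: hn => + _; exact/lt_trans/expR_gt0.
set x' := iter n (aut_inv T) x in hn An *.
exists (- ceiling_sum T xi n x').
  by right => /=; rewrite !ltrN2 andbC.
have [_ _ /(_ (x', 0) (f0 _)) <-//] :=
  built_flowP xi_gt0 (- ceiling_sum T xi n x') (f0 x) dx.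
have cs0 : 0 < ceiling_sum T xi n x'.
  by case/andP: hn => + _; exact/lt_trans/expR_gt0.
rewrite /flow_graph oppr_gt0 (ltNge _ 0) (ltW cs0)/= oppr_lt0 cs0 opprK.
have xE : iter n T x' = x by rewrite /x' (iter_cancel _ (aut_invK T)).
by have := fwd n x'; rewrite xE.
Qed.

Lemma measurable_Delta (delta s : R) (A : set X) : 0 < delta -> measurable A ->
  measurable (Delta T xi delta s A).
Proof.
move=> d0 mA; rewrite DeltaE//; apply: measurableI => //.
have mT n : measurable_fun setT (iter n T).
  by apply: measurable_iter; exact: measurable_aut.
have mV n : measurable_fun setT (iter n (aut_inv T)).
  by apply: measurable_iter; exact: measurable_aut_inv.
have mH n : measurable (ceiling_hit delta s n).
  have mS : measurable_fun setT (ceiling_sum T xi n).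
    by apply: measurable_sum => i; apply: measurableT_comp.
  have -> : ceiling_hit delta s n = setT `&`
      ceiling_sum T xi n @^-1` `]expR (s - delta), expR (s + delta)[.
    by rewrite setTI; apply/seteqP; split => x /=; rewrite in_itv.
  by apply: mS => //; exact: measurable_itv.
apply: measurableU.
  by apply: measurableC; exact: measurable_divergence_set.
apply: bigcupT_measurable => n; apply: measurableU.
  by apply: measurableI => //; rewrite -[X in measurable X]setTI; exact: mT.
by rewrite -[X in measurable X]setTI; apply: mV => //; exact: measurableI.
Qed.

(** * Transfer of property B *)

Lemma flow_measureE (A : set (X * measurableTypeR R)) :
  A `<=` flow_space xi ->
  flow_measure mu xi A = (mu \x lebesgue_measure)%E A.
Proof. by move=> AY; rewrite /flow_measure /= /mrestr setIidl. Qed.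

(** The base set consists of the points over which a bounded part of [A] has
    sections of length bounded below. *)
Lemma property_B_base :
  property_B (flow_measure mu xi) (flow_space xi) (built_flow T xi) ->
  exists A0 : set X, [/\ measurable A0, (0 < mu A0)%E &
    forall delta : R, 0 < delta ->
      limf_esup (fun s : R => mu (Delta T xi delta s A0)) +oo%R = 0%E].
Proof.
move=> [A [mA AY nuA limA]].
rewrite flow_measureE// in nuA.
pose low n : set (X * measurableTypeR R) := A `&` [set y | y.2 < n.+1%:R].
have mlow n : measurable (low n).
  apply: measurableI => //.
  have -> : [set y : X * R | y.2 < n.+1%:R] =
      setT `&` snd @^-1` `]-oo, n.+1%:R[.
    by rewrite setTI; apply/seteqP; split=> y /=; rewrite in_itv.
  by apply: measurable_snd => //; exact: measurable_itv.
have [|N nuN] := @measure_bigcup_gt0 _ _ _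
    (mu \x lebesgue_measure)%E low mlow.
  rewrite (_ : \bigcup_k low k = A)//; apply/seteqP.
  split => [y [n _ []]//|y Ay].
  by exists (Num.truncn y.2) => //; split => //=; rewrite truncnS_gt.
have [k muk] := product_measure_gt0_sections (mlow N) nuN.
set A0 := [set x | _] in muk.
have mA0 : measurable A0 by exact: measurable_xsection_gt.
have c0 : 0 < k.+1%:R^-1 :> R by rewrite invr_gt0.
exists A0; split => // delta d0.
have d20 : 0 < 2 * delta by rewrite mulr_gt0.
apply: (@limf_esup_eq0_dominated _ _ _ k.+1%:R _ _ _ _ _ _ (limA _ d20)).
+ by [].
+ by move=> s; apply: mu_ext_ge0 => B; exact: measure_ge0.
+ by move=> s; exact: measure_ge0.
near=> s.
have mD := measurable_Delta s d0 mA0.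
set D := Delta _ _ _ _ _ in mD *.
pose C : set (X * measurableTypeR R) := low N `&` (D `*` setT).
have mC : measurable C by apply: measurableI => //; exact: measurableX.
have CA : C `<=` flow_space xi by move=> y [[/AY]].
have CL : C `<=` Lambda (built_flow T xi) (2 * delta) s A.
  move=> [x u] [lowxu [/= /Delta_Lambda Dx _]].
  have lowP (z : X * R) : low N z -> flow_space xi z /\ z.2 < N.+1%:R.
    by move=> [/AY].
  have botP (z : X * R) : (A0 `*` [set 0]) z ->
      flow_space xi z /\ z.2 < N.+1%:R.
    by move=> [_ /= z0]; rewrite /flow_space /= z0 lexx xi_gt0 ltr0n.
  have fibre (z : X * R) : (A0 `*` [set 0]) z ->
      exists2 z', low N z' & z'.1 = z.1.
    move=> [A0z _].
    have /set0P[v /xsectionP lowv] : xsection (low N) z.1 != set0.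
      apply/eqP => z0; move: A0z; rewrite /A0 /= z0 measure0.
      by rewrite lte_fin ltNge (ltW c0).
    by exists (z.1, v).
  have sN : 2 * delta + 2 * N.+1%:R / delta <= s.
    by near: s; apply: nbhs_pinfty_ge; exact: num_real.
  have [_ [t wt [lowF _]]] :=
    Lambda_shift d0 (ler0n _ _) sN botP lowP fibre
      (erefl : (x, u).1 = (x, 0).1) lowxu Dx.
  by split; [case: lowxu|exists t].
rewrite -lee_pdivrMl//; apply: (@le_trans _ _ (flow_measure mu xi C)).
  rewrite flow_measureE//; apply: product_measure_ge_sections => //.
  move=> x Dx; apply: ltW.
  have -> : xsection C x = xsection (low N) x.
    by rewrite /C xsectionI in_xsectionX ?setIT// inE.
  by case: Dx.
by rewrite -measurable_mu_extE//; exact: le_mu_ext.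
Unshelve. all: by end_near. Qed.

(** The flow set is a rectangle of small height over part of [A0]. *)
Lemma property_B_of_base (A0 : set X) :
  measurable A0 -> (0 < mu A0)%E ->
  (forall delta : R, 0 < delta ->
      limf_esup (fun s : R => mu (Delta T xi delta s A0)) +oo%R = 0%E) ->
  property_B (flow_measure mu xi) (flow_space xi) (built_flow T xi).
Proof.
move=> mA0 muA0 limA0.
pose E k := A0 `&` [set x | k.+1%:R^-1 < xi x].
have mE k : measurable (E k).
  apply: measurableI => //.
  have -> : [set x | k.+1%:R^-1 < xi x] = setT `&` xi @^-1` `]k.+1%:R^-1, +oo[.
    by rewrite setTI; apply/seteqP; split=> y /=; rewrite in_itv/= andbT.
  by apply: measurable_funPT => //; exact: measurable_itv.
have [|k muE] := measure_bigcup_gt0 (mu := mu) mE.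
  rewrite (_ : \bigcup_k E k = A0)//; apply/seteqP.
  split => [x [k _ []]//|x Ax].
  have [k xk] := ltr_add_invr (xi_gt0 x); exists k => //; split => //=.
  by move: xk; rewrite add0r.
set c : R := k.+1%:R^-1.
have c0 : 0 < c by rewrite invr_gt0.
pose A : set (X * measurableTypeR R) := E k `*` `[0, c[%classic.
have mI : measurable (`[0, c[%classic : set (measurableTypeR R)).
  exact: measurable_itv.
have lebI : lebesgue_measure (`[0, c[%classic : set R) = c%:E.
  by rewrite lebesgue_measure_itv/= lte_fin c0 sube0.
have productE (D : set X) : measurable D ->
    (mu \x lebesgue_measure)%E (D `*` `[0, c[%classic) = (c%:E * mu D)%E.
  by move=> mD; rewrite product_measure1E// muleC; congr (_ * _)%E.
have AP (y : X * R) : A y -> flow_space xi y /\ y.2 < c.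
  move=> [[_ /= cx]]; rewrite in_itv/= => /andP[y0 yc].
  by rewrite /flow_space /= y0 yc (lt_trans yc cx).
have AY : A `<=` flow_space xi by move=> y /AP[].
exists A; split => //.
+ exact: measurableX.
+ by rewrite flow_measureE// productE//; apply: mule_gt0; rewrite ?lte_fin.
move=> delta d0; have d20 : 0 < 2 * delta by rewrite mulr_gt0.
apply: (@limf_esup_eq0_dominated _ _ _ c _ _ _ _ _ _ (limA0 _ d20)).
+ by [].
+ by move=> s; exact: measure_ge0.
+ by move=> s; apply: mu_ext_ge0 => B; exact: measure_ge0.
near=> s.
have mD := measurable_Delta s d20 mA0.
set D := Delta _ _ _ _ _ in mD *.
have botP (z : X * R) : (A0 `*` [set 0]) z -> flow_space xi z /\ z.2 < c.
  by move=> [_ /= z0]; rewrite /flow_space /= z0 lexx xi_gt0.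
have fibre (z : X * R) : A z ->
    exists2 z' : X * R, (A0 `*` [set 0]) z' & z'.1 = z.1.
  by move=> [[A0z _] _]; exists (z.1, 0).
have sc : 2 * delta + 2 * c / delta <= s.
  by near: s; apply: nbhs_pinfty_ge; exact: num_real.
pose C : set (X * measurableTypeR R) := D `*` `[0, c[%classic.
have mC : measurable C by exact: measurableX.
have LC : Lambda (built_flow T xi) delta s A `<=` C.
  move=> [x u] /[dup] L [[[A0x _] Iu] _]; split => //=.
  apply/Delta_Lambda.
  have Bx : (A0 `*` [set 0]) (x, 0 : R) by [].
  exact: (Lambda_shift d0 (ltW c0) sc AP botP fibre
    (erefl : (x, 0).1 = (x, u).1) Bx L).
apply: (@le_trans _ _ (flow_measure mu xi C)).
  by rewrite -measurable_mu_extE//; exact: le_mu_ext.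
rewrite -productE// /flow_measure /= /mrestr.
by apply: le_measure; rewrite ?inE//; apply: measurableI => //;
  exact: measurable_flow_space.
Unshelve. all: by end_near. Qed.

End returns.

Theorem proposition3p4 (R : realType) (d : measure_display)
    (X0 : measurableType d)
    (mu0 : {sigma_finite_measure set X0 -> \bar R})
    (X0_standard : standard_borel R X0)
    (T : automorphism mu0)
    (xi : {mfun X0 >-> R}) (xi_gt0 : forall x : X0, 0 < xi x)
    (xi_divergent : {ae mu0, forall x : X0, divergence_set T xi x}) :
  property_B (flow_measure mu0 xi) (flow_space xi) (built_flow T xi)
  <->
  exists A0 : set X0, [/\ measurable A0, (0 < mu0 A0)%E &
    forall delta : R, 0 < delta ->
      limf_esup (fun s : R => mu0 (Delta T xi delta s A0)) +oo%R = 0%E].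
Proof.
split; first exact: property_B_base.
by move=> [A0 [mA0 muA0 limA0]]; exact: property_B_of_base limA0.
Qed.
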